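(* Let $A,B,C,A',B',C'$ be six distinct points on the real (resp. complex) projective plane. Let $p,q,r,p',q',r'$ be six lines none of which passes through any of those six points. If eleven of the twelve triples of lines $$\{p,q,(A'C)\},\ \{q,r,(BC')\},\ \{p,r,(AB')\},\ \{p',q',(AC')\},\ \{q',r',(B'C)\},\ \{p',r',(A'B)\},$$ $$\{p,q',(AC)\},\ \{q,r',(BC)\},\ \{p',r,(AB)\},\ \{p',q,(A'C')\},\ \{q',r,(B'C')\},\ \{p,r',(A'B')\}$$ are concurrent, then the twelfth triple is concurrent as well.
   Context: $(XY)$ denotes the line through two distinct points $X,Y$. Lines are concurrent if they have a common point. *)

(* Defs.v *)
From HB Require Import structures.
From mathcomp Require Import all_boot all_order all_algebra.
From mathcomp Require Import reals complex.
Set Implicit Arguments.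
Unset Strict Implicit.
Unset Printing Implicit Defensive.
Import GRing.Theory.
Local Open Scope ring_scope.

Variant scalar_kind := RealScalars | ComplexScalars.

Definition scalars (R : realType) (k : scalar_kind) : fieldType :=
  match k with RealScalars => R | ComplexScalars => R[i] end.

Section ProjectivePlane.
Variable K : fieldType.

(* The projective plane over K is P(K^3): its points and lines are the
   subspaces of K^3 of dimension 1 and 2, and incidence is inclusion. *)

Record point := Point
  { point_vspace :> {vspace 'rV[K]_3}; _ : \dim point_vspace == 1%N }.

HB.instance Definition _ := [isSub for point_vspace].
HB.instance Definition _ := [Choice of point by <:].

Record line := Line
  { line_vspace :> {vspace 'rV[K]_3}; _ : \dim line_vspace == 2%N }.

HB.instance Definition _ := [isSub for line_vspace].
HB.instance Definition _ := [Choice of line by <:].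

Definition on (X : point) (l : {vspace 'rV[K]_3}) : bool := (X <= l)%VS.

(* The line (XY), as a subspace; it has dimension 2 only if X != Y, see
   [dim_join]. *)
Definition join (X Y : point) : {vspace 'rV[K]_3} := (X + Y)%VS.

Lemma dim_join (X Y : point) : X != Y -> \dim (join X Y) = 2%N.
Proof.
case: X Y => [X dX] [Y dY]; rewrite -val_eqE /join /= => neqXY.
have dI : (\dim (X :&: Y) = 0)%N.
  have := dimvS (capvSl X Y); rewrite (eqP dX).
  case E: (\dim _) => [//|[|//]] _.
  have/eqP eXI : (X :&: Y == X)%VS by rewrite eqEdim capvSl (eqP dX) E.
  by case/eqP: neqXY; apply/eqP; rewrite eqEdim (eqP dX) (eqP dY) -eXI capvSr.
by have := dimv_sum_cap X Y; rewrite dI addn0 (eqP dX) (eqP dY).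
Qed.

Definition concurrent (l m n : {vspace 'rV[K]_3}) : Prop :=
  exists P : point, [/\ on P l, on P m & on P n].

End ProjectivePlane.

(* Main.v *)
Require Import Defs.
From HB Require Import structures.
From mathcomp Require Import all_boot all_order all_algebra.
From mathcomp Require Import reals complex.
From mathcomp Require Import ring.
Import GRing.Theory.
Local Open Scope ring_scope.

(** Choose a linear form for each line and a spanning vector for each point,
    and write l(X) for the value of the form of l at the vector of X
    ([pairing]). When X and Y are distinct points outside l and m, the lines l,
    m and (XY) are concurrent exactly when the two forms are proportional on the
    plane spanned by the vectors of X and Y, that is, when the mixed ratio

      (l(X) / l(Y)) (m(Y) / m(X))

    equals 1 ([concurrentE]). Neither choice of scaling affects this ratio.

    Regard each triple {l, m, (XY)} as a quadrilateral with vertices l, X, m, Y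
    in cyclic order. The twelve quadrilaterals tile a torus: around p, for
    instance, the points A', C, A, B' follow each other cyclically, two
    consecutive ones for each of the four triples that contain p. With all
    quadrilaterals oriented coherently, the factors of the twelve mixed ratios
    that belong to a given line telescope around that line, for instance

      (p(A') / p(C)) (p(C) / p(A)) (p(A) / p(B')) (p(B') / p(A')) = 1

    ([ratio_cycle]). So the product of the twelve mixed ratios is 1, and if
    eleven of them are 1, so is the last ([nth_prod_eq1]). The argument is valid
    over any field ([torus_incidence]). *)

Section MixedRatio.
Variable K : fieldType.
Implicit Types (X Y : point K) (l m : line K) (v : 'rV[K]_3).

(** * Linear forms of lines and vectors of points *)

Lemma line_complement_neq0 l : vpick (l^C)%VS != 0.
Proof.
rewrite vpick0 -dimv_eq0 dimv_compl dimvf.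
by case: l => U /= /eqP ->; rewrite /dim.
Qed.

Lemma line_complement_cap l : (<[vpick (l^C)%VS]> :&: l = 0)%VS.
Proof.
apply/eqP; rewrite -subv0 -(capv_compl l) [(l :&: _)%VS]capvC.
by rewrite capvS // -memvE memv_pick.
Qed.

Lemma line_complement_add l : (<[vpick (l^C)%VS]> + l = fullv)%VS.
Proof.
apply/eqP; rewrite eqEdim subvf /= dimv_disjoint_sum ?line_complement_cap //.
rewrite dimvf dim_vline line_complement_neq0.
by case: l => U /= /eqP ->.
Qed.

(** A vector [e] outside [l] splits the space into the directions of [e] and
    [l]; the coordinate along [e] is a linear form with kernel [l]. *)
Definition line_form l v : K :=
  let e := vpick (l^C)%VS in coord [tuple e] ord0 (daddv_pi <[e]> l v).

Lemma line_form_is_linear l : linear (line_form l : 'rV[K]_3 -> K^o).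
Proof. by move=> a u v; rewrite /line_form !linearP. Qed.

HB.instance Definition _ l :=
  GRing.isLinear.Build K 'rV[K]_3 K^o _ (line_form l : _ -> K^o)
    (line_form_is_linear l).

Lemma line_formP l v : (line_form l v == 0) = (v \in (l : {vspace _})).
Proof.
have cap := line_complement_cap l.
have capC : (l :&: <[vpick (l^C)%VS]> = 0)%VS by rewrite capvC.
rewrite /line_form; set e := vpick _ in cap capC *.
have e_free : free [tuple e] by rewrite seq1_free line_complement_neq0.
have dec : daddv_pi <[e]> l v + daddv_pi l <[e]> v = v.
  by apply: daddv_pi_add; rewrite ?line_complement_add ?memvf.
apply/eqP/idP => [form0 | lv].
  have /vlineP[a pi_v] := memv_pi <[e]>%VS l v.
  move: form0; rewrite pi_v linearZ /= (coord_free ord0 ord0 e_free) mulr1.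
  by move=> a0; rewrite -dec pi_v a0 scale0r add0r memv_pi.
suff -> : daddv_pi <[e]> l v = 0 by rewrite linear0.
by move: dec; rewrite (daddv_pi_id capC lv) -[X in _ = X]add0r => /addIr.
Qed.

Lemma point_spanned X : (X : {vspace _}) = <[vpick X]>%VS.
Proof.
have X1 : \dim X = 1%N by case: X => U /= /eqP.
apply/eqP; rewrite eq_sym eqEdim -memvE memv_pick dim_vline vpick0 X1.
by rewrite -dimv_eq0 X1.
Qed.

Lemma point_vector_neq0 X : vpick X != 0.
Proof. by rewrite vpick0 -dimv_eq0; case: X => U /= /eqP ->. Qed.

Definition pairing l X : K := line_form l (vpick X).

Lemma on_pairing X l : on X l = (pairing l X == 0).
Proof. by rewrite /on {1}point_spanned -memvE line_formP. Qed.

Lemma memv_join X Y v :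
  reflect (exists a b, v = a *: vpick X + b *: vpick Y) (v \in join X Y).
Proof.
rewrite /join (point_spanned X) (point_spanned Y).
apply: (iffP memv_addP) => [[_ /vlineP[a ->] [_ /vlineP[b ->] ->]] | [a [b ->]]].
  by exists a, b; rewrite -!point_spanned.
rewrite -!point_spanned; exists (a *: vpick X); first by rewrite memvZ ?memv_pick.
by exists (b *: vpick Y); rewrite ?memvZ ?memv_pick.
Qed.

Lemma joinC X Y : join X Y = join Y X.
Proof. exact: addvC. Qed.

Lemma vector_on P (U : {vspace 'rV[K]_3}) : on P U = (vpick P \in U).
Proof. by rewrite /on point_spanned -memvE -point_spanned. Qed.

Lemma concurrent_vector (U V W : {vspace 'rV[K]_3}) :
  concurrent U V W <-> exists2 v, v != 0 & [/\ v \in U, v \in V & v \in W].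
Proof.
split=> [[P []] | [v v0 [vU vV vW]]].
  by rewrite !vector_on => *; exists (vpick P); rewrite ?point_vector_neq0.
have dv : \dim <[v]> == 1%N by rewrite dim_vline v0.
by exists (Point dv); rewrite /on /= -!memvE.
Qed.

(** * Concurrency as an equation between mixed ratios *)

Definition ratio l X Y : K := pairing l X / pairing l Y.

Definition mixed_ratio l m X Y : K := ratio l X Y * ratio m Y X.

(** Both forms vanish at a vector a x + b y of the plane (XY) when (a, b) solves
    a 2 x 2 homogeneous linear system, whose determinant is
    l(X) m(Y) - l(Y) m(X). So a common point makes it vanish. When it
    vanishes, l(Y) x - l(X) y is a common vector, and it is nonzero because
    l(Y) != 0 and x, y are independent. *)
Lemma concurrentE l m X Y :
    X != Y -> pairing l Y != 0 -> pairing m X != 0 -> pairing m Y != 0 ->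
  concurrent l m (join X Y) <-> mixed_ratio l m X Y = 1.
Proof.
move=> neqXY lY mX mY; rewrite concurrent_vector.
have pairing_comb n a b :
    line_form n (a *: vpick X + b *: vpick Y) = a * pairing n X + b * pairing n Y.
  by rewrite linearD !linearZ.
have ratio1 : mixed_ratio l m X Y = 1 <->
    pairing l X * pairing m Y = pairing l Y * pairing m X.
  rewrite /mixed_ratio /ratio mulf_div; split=> [det1 | ->].
    by rewrite -[RHS]mul1r -det1 divfK ?mulf_neq0.
  by rewrite divff ?mulf_neq0.
rewrite ratio1; split=> [[v v0 [vl vm /memv_join[a [b def_v]]]] | det0].
  move: vl vm; rewrite -!line_formP def_v !pairing_comb.
  move=> /eqP l0 /eqP m0.
  have a0 : a != 0.
    apply: contraNneq v0 => a0; move/eqP: l0; rewrite def_v a0 mul0r add0r.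
    by rewrite mulf_eq0 (negPf lY) orbF scale0r add0r => /eqP ->; rewrite scale0r.
  apply: (mulfI a0); apply/eqP; rewrite -subr_eq0; apply/eqP.
  transitivity ((a * pairing l X + b * pairing l Y) * pairing m Y
                - pairing l Y * (a * pairing m X + b * pairing m Y)); first by ring.
  by rewrite l0 m0 mul0r mulr0 subr0.
exists (pairing l Y *: vpick X + - pairing l X *: vpick Y).
  apply: contraNneq neqXY => /eqP; rewrite scaleNr subr_eq0 => /eqP dep.
  rewrite -val_eqE /= eqEdim; apply/andP; split; last first.
    by case: (X) (Y) => [U /= /eqP ->] [V /= /eqP ->].
  rewrite (point_spanned X) -memvE -[vpick X]scale1r -(mulVf lY) -scalerA dep.
  by rewrite !memvZ ?memv_pick.
split; last by apply/memv_join; exists (pairing l Y), (- pairing l X).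
  by rewrite -line_formP pairing_comb; apply/eqP; ring.
by rewrite -line_formP pairing_comb mulNr det0 subrr.
Qed.

(** * The toric tiling *)

Lemma ratio_cycle l X Y Z W :
    pairing l X != 0 -> pairing l Y != 0 -> pairing l Z != 0 ->
    pairing l W != 0 ->
  ratio l X Y * ratio l Y Z * ratio l Z W * ratio l W X = 1.
Proof. by move=> X0 Y0 Z0 W0; rewrite /ratio !mulrA !divfK ?divff. Qed.

Lemma nth_prod_eq1 (s : seq K) i :
    \prod_(x <- s) x = 1 ->
    (forall j, (j < size s)%N -> j != i -> nth 1 s j = 1) ->
  nth 1 s i = 1.
Proof.
move=> prod1 others; have [lt_is | ge_is] := ltnP i (size s); last first.
  by rewrite nth_default.
move: prod1; rewrite (big_nth 1) big_mkord (bigD1 (Ordinal lt_is)) //= big1.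
  by rewrite mulr1.
by move=> j neq_ji; apply: others.
Qed.

Lemma torus_incidence (A B C A' B' C' : point K) (p q r p' q' r' : line K)
    (points_distinct : uniq [:: A; B; C; A'; B'; C'])
    (points_off_lines :
       forall X, X \in [:: A; B; C; A'; B'; C'] ->
       forall l, l \in [:: p; q; r; p'; q'; r'] -> ~~ on X l) :
  let triples : seq Prop :=
    [:: concurrent p q (join A' C);
        concurrent q r (join B C');
        concurrent p r (join A B');
        concurrent p' q' (join A C');
        concurrent q' r' (join B' C);
        concurrent p' r' (join A' B);
        concurrent p q' (join A C);
        concurrent q r' (join B C);
        concurrent p' r (join A B);
        concurrent p' q (join A' C');
        concurrent q' r (join B' C');
        concurrent p r' (join A' B')] in
  forall i : nat, (i < size triples)%N ->
    (forall j : nat, (j < size triples)%N -> j != i -> nth True triples j) ->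
    nth True triples i.
Proof.
move=> triples.
have := points_distinct; rewrite /= !inE !negb_or -!andbA.
case/and5P=> AB AC _ AB' /and5P[AC' BC A'B _ /and5P[BC' A'C B'C _]].
case/and3P=> A'B' A'C' /andP[B'C' _].
rewrite eq_sym in A'B; rewrite eq_sym in A'C; rewrite eq_sym in B'C.
move: points_off_lines.
set points := [:: A; B; C; A'; B'; C']; set lines := [:: p; q; r; p'; q'; r'].
move=> off_lines.
have /and5P[AP BP CP A'P /and3P[B'P C'P _]] : all [in points] points.
  exact/allP.
have /and5P[pL qL rL p'L /and3P[q'L r'L _]] : all [in lines] lines.
  exact/allP.
have off X l : X \in points -> l \in lines -> pairing l X != 0.
  by move=> XP lL; rewrite -on_pairing off_lines.
(* From here on only membership in the two lists matters, not their content. *)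
clearbody points lines.
(* The order of the two points in each ratio is that of a coherent orientation
   of the torus. *)
pose ratios :=
  [:: mixed_ratio p q A' C; mixed_ratio q r C' B; mixed_ratio p r A B';
      mixed_ratio p' q' A C'; mixed_ratio q' r' C B'; mixed_ratio p' r' A' B;
      mixed_ratio p q' C A; mixed_ratio q r' B C; mixed_ratio p' r B A;
      mixed_ratio p' q C' A'; mixed_ratio q' r B' C'; mixed_ratio p r' B' A'].
have tile X Y l m : X != Y -> X \in points -> Y \in points ->
    l \in lines -> m \in lines ->
    concurrent l m (join X Y) <-> mixed_ratio l m X Y = 1.
  by move=> *; apply: concurrentE => //; apply: off.
have tile_rev X Y l m : Y != X -> X \in points -> Y \in points ->
    l \in lines -> m \in lines ->
    concurrent l m (join Y X) <-> mixed_ratio l m X Y = 1.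
  by rewrite joinC eq_sym; apply: tile.
have triplesE j : (j < 12)%N -> nth True triples j <-> nth 1 ratios j = 1.
  case: j => [|[|[|[|[|[|[|[|[|[|[|[|//]]]]]]]]]]]] _ /=;
    [exact: (tile _ _ _ _ A'C) | exact: (tile_rev _ _ _ _ BC') |
     exact: (tile _ _ _ _ AB') | exact: (tile _ _ _ _ AC') |
     exact: (tile_rev _ _ _ _ B'C) | exact: (tile _ _ _ _ A'B) |
     exact: (tile_rev _ _ _ _ AC) | exact: (tile _ _ _ _ BC) |
     exact: (tile_rev _ _ _ _ AB) | exact: (tile_rev _ _ _ _ A'C') |
     exact: (tile _ _ _ _ B'C') | exact: (tile_rev _ _ _ _ A'B')].
have prod1 : \prod_(x <- ratios) x = 1.
  rewrite /ratios !big_cons big_nil /mixed_ratio.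
  have cycle l X Y Z W : l \in lines -> X \in points -> Y \in points ->
      Z \in points -> W \in points ->
      ratio l X Y * ratio l Y Z * ratio l Z W * ratio l W X = 1.
    by move=> *; apply: ratio_cycle; apply: off.
  (* Regrouping by lines follows the cycle of four points around each line. *)
  transitivity
    ((ratio p A' C * ratio p C A * ratio p A B' * ratio p B' A') *
     (ratio q C A' * ratio q A' C' * ratio q C' B * ratio q B C) *
     (ratio r B C' * ratio r C' B' * ratio r B' A * ratio r A B) *
     (ratio p' A C' * ratio p' C' A' * ratio p' A' B * ratio p' B A) *
     (ratio q' C' A * ratio q' A C * ratio q' C B' * ratio q' B' C') *
     (ratio r' B' C * ratio r' C B * ratio r' B A' * ratio r' A' B')).
    ring.
  by rewrite !cycle ?mulr1.
move=> i lt_i others; apply/(triplesE i lt_i)/nth_prod_eq1 => // j lt_j neq_ji.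
exact/(triplesE j lt_j)/others.
Qed.

End MixedRatio.

Theorem theorem3p15 (R : realType) (k : scalar_kind)
    (A B C A' B' C' : point (scalars R k))
    (p q r p' q' r' : line (scalars R k))
    (points_distinct : uniq [:: A; B; C; A'; B'; C'])
    (points_off_lines :
       forall X, X \in [:: A; B; C; A'; B'; C'] ->
       forall l, l \in [:: p; q; r; p'; q'; r'] -> ~~ on X l) :
  let triples : seq Prop :=
    [:: concurrent p q (join A' C);
        concurrent q r (join B C');
        concurrent p r (join A B');
        concurrent p' q' (join A C');
        concurrent q' r' (join B' C);
        concurrent p' r' (join A' B);
        concurrent p q' (join A C);
        concurrent q r' (join B C);
        concurrent p' r (join A B);
        concurrent p' q (join A' C');
        concurrent q' r (join B' C');
        concurrent p r' (join A' B')] in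
  forall i : nat, (i < size triples)%N ->
    (forall j : nat, (j < size triples)%N -> j != i -> nth True triples j) ->
    nth True triples i.
Proof. exact: torus_incidence points_distinct points_off_lines. Qed.
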